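(* There is a family $\mathfrak D$ of groups that does not recognize coordinates, but every finite subset of $\mathfrak D$ recognizes coordinates. Moreover, all groups in $\mathfrak D$ are indecomposable and perfect; in particular, there is no nontrivial homomorphism from a group in $\mathfrak D$ into the center of a group in $\mathfrak D$.
   Context: A group is indecomposable if it is not a direct product of two nontrivial groups, and perfect if it equals its commutator subgroup. Reduced product: for an ideal $\mathcal I$ on $\mathbb I$ (closed under subsets and finite unions, $\mathbb I\notin\mathcal I$), $\prod_{\mathcal I}G_i$ is $\prod_iG_i$ modulo $(a_i)\simeq(b_i)\iff\{i\mid a_i\ne b_i\}\in\mathcal I$; $\mathcal M\restriction S$, $\pi_S$ denote the quotient onto (a representative of) $S\in\mathcal P(\mathbb I)/\mathcal I$ and its quotient map. An isomorphism $\Phi:\prod_{\mathcal I}G_i\to\prod_{\mathcal J}H_j$ is isomorphically coordinate respecting if there is an isomorphism $\alpha:\mathcal P(\mathbb I)/\mathcal I\to\mathcal P(\mathbb J)/\mathcal J$ such that for all $S$ the map $\pi_S(a)\mapsto\pi_{\alpha(S)}(\Phi(a))$ is well defined. A class recognizes coordinates if every isomorphism between reduced products (any index sets, ideals, repetitions allowed) of its members is isomorphically coordinate respecting. *)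

(* Defs.v *)
From HB Require Import structures.
From mathcomp Require Import all_boot all_order.
From mathcomp Require Import boolp classical_sets functions cardinality.

Set Implicit Arguments.
Unset Strict Implicit.
Unset Printing Implicit Defensive.

Import Order.Theory.
Local Open Scope classical_set_scope.
Local Open Scope quotient_scope.

(* Properness is kept separate: the ideal [restr_ideal N S] below, which
   defines the restriction of a reduced product to S, is improper when S is
   in N. *)
Record ideal (I : Type) := Ideal {
  ideal_set :> set I -> Prop;
  ideal0 : ideal_set set0;
  idealS : forall A B, A `<=` B -> ideal_set B -> ideal_set A;
  idealU : forall A B, ideal_set A -> ideal_set B -> ideal_set (A `|` B) }.

Definition proper_ideal (I : Type) (N : ideal I) : Prop := ~ N setT.

Section RestrIdeal.
Variables (I : Type) (N : ideal I) (S : set I).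

Lemma restr_ideal0 : N (set0 `&` S).
Proof. by rewrite set0I; exact: ideal0. Qed.

Lemma restr_idealS A B : A `<=` B -> N (B `&` S) -> N (A `&` S).
Proof. by move=> AB; apply: idealS; exact: setSI. Qed.

Lemma restr_idealU A B :
  N (A `&` S) -> N (B `&` S) -> N ((A `|` B) `&` S).
Proof. by rewrite setIUl; exact: idealU. Qed.

Definition restr_ideal : ideal I :=
  @Ideal I [set A | N (A `&` S)] restr_ideal0 restr_idealS restr_idealU.

End RestrIdeal.

Section PowersetMod.
Variables (I : Type) (N : ideal I).

Definition set_eqmod : rel (set I) := fun A B => `[< N (A `+` B) >].

Lemma set_eqmod_refl : reflexive set_eqmod.
Proof. by move=> A; apply/asboolP; rewrite setYK; exact: ideal0. Qed.

Lemma set_eqmod_sym : symmetric set_eqmod.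
Proof. by move=> A B; rewrite /set_eqmod setYC. Qed.

Lemma set_eqmod_trans : transitive set_eqmod.
Proof.
move=> B A C /asboolP NAB /asboolP NBC; apply/asboolP.
apply: idealS (idealU NAB NBC) => i /=.
have [Bi|Bi] := pselect (B i); tauto.
Qed.

Canonical set_eqmod_equiv :=
  EquivRel set_eqmod set_eqmod_refl set_eqmod_sym set_eqmod_trans.

Definition powmod : Type := {eq_quot set_eqmod}.

HB.instance Definition _ := Choice.on powmod.
HB.instance Definition _ := EqQuotient.on powmod.

Definition set_class (A : set I) : powmod := \pi_powmod A.

Lemma set_class_repr (x : powmod) : set_class (repr x) = x.
Proof. exact: reprK. Qed.

Lemma set_classP A B : set_class A = set_class B <-> N (A `+` B).
Proof.
split=> [/eqmodP /asboolP //|NAB].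
by apply/eqmodP; apply/asboolP.
Qed.

Lemma repr_set_class A : N (repr (set_class A) `+` A).
Proof. by apply/set_classP; rewrite set_class_repr. Qed.

Definition powmod_meet (x y : powmod) := set_class (repr x `&` repr y).
Definition powmod_join (x y : powmod) := set_class (repr x `|` repr y).
Definition powmod_compl (x : powmod) := set_class (~` repr x).

Lemma powmod_meetE A B :
  powmod_meet (set_class A) (set_class B) = set_class (A `&` B).
Proof.
apply/set_classP.
apply: idealS (idealU (repr_set_class A) (repr_set_class B)) => i /=.
by have [?|?] := pselect (repr (set_class A) i);
  have [?|?] := pselect (A i); have [?|?] := pselect (B i); tauto.
Qed.

Lemma powmod_joinE A B :
  powmod_join (set_class A) (set_class B) = set_class (A `|` B).
Proof.
apply/set_classP.
apply: idealS (idealU (repr_set_class A) (repr_set_class B)) => i /=.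
by have [?|?] := pselect (repr (set_class A) i);
  have [?|?] := pselect (A i); have [?|?] := pselect (B i); tauto.
Qed.

Lemma powmod_complE A : powmod_compl (set_class A) = set_class (~` A).
Proof.
apply/set_classP; apply: idealS (repr_set_class A) => i /=.
have [Ai|Ai] := pselect (A i);
  have [Ri|Ri] := pselect (repr (set_class A) i); tauto.
Qed.

Lemma powmod_ind (P : powmod -> Prop) :
  (forall A, P (set_class A)) -> forall x, P x.
Proof. by move=> PA x; rewrite -(set_class_repr x). Qed.

Let meetC : commutative powmod_meet.
Proof. by move=> x y; rewrite /powmod_meet setIC. Qed.

Let joinC : commutative powmod_join.
Proof. by move=> x y; rewrite /powmod_join setUC. Qed.

Let meetA : associative powmod_meet.
Proof.
elim/powmod_ind=> A; elim/powmod_ind=> B; elim/powmod_ind=> C.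
by rewrite !powmod_meetE setIA.
Qed.

Let joinA : associative powmod_join.
Proof.
elim/powmod_ind=> A; elim/powmod_ind=> B; elim/powmod_ind=> C.
by rewrite !powmod_joinE setUA.
Qed.

Let joinKI y x : powmod_meet x (powmod_join x y) = x.
Proof.
elim/powmod_ind: x => A; elim/powmod_ind: y => B.
by rewrite powmod_joinE powmod_meetE setUC setKU.
Qed.

Let meetKU y x : powmod_join x (powmod_meet x y) = x.
Proof.
elim/powmod_ind: x => A; elim/powmod_ind: y => B.
by rewrite powmod_meetE powmod_joinE setIC setKI.
Qed.

Let meetUl : left_distributive powmod_meet powmod_join.
Proof.
elim/powmod_ind=> A; elim/powmod_ind=> B; elim/powmod_ind=> C.
by rewrite powmod_joinE !powmod_meetE powmod_joinE setIUl.
Qed.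

Let meetxx : idempotent_op powmod_meet.
Proof. by elim/powmod_ind=> A; rewrite powmod_meetE setIid. Qed.

HB.instance Definition _ := Order.isMeetJoinDistrLattice.Build
  set_display powmod (fun _ _ => erefl) (fun _ _ => erefl)
  meetC joinC meetA joinA joinKI meetKU meetUl meetxx.

Let le0x (x : powmod) : (set_class set0 <= x)%O.
Proof.
elim/powmod_ind: x => A; apply/eqP.
by rewrite [LHS]powmod_meetE set0I.
Qed.

Let lex1 (x : powmod) : (x <= set_class setT)%O.
Proof.
elim/powmod_ind: x => A; apply/eqP.
by rewrite [LHS]powmod_meetE setIT.
Qed.

HB.instance Definition _ := Order.hasBottom.Build set_display powmod le0x.
HB.instance Definition _ := Order.hasTop.Build set_display powmod lex1.

Let joinxC (x : powmod) : (x `|` powmod_compl x = \top)%O.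
Proof.
elim/powmod_ind: x => A.
by rewrite powmod_complE [LHS]powmod_joinE setUv.
Qed.

Let meetxC (x : powmod) : (x `&` powmod_compl x = \bot)%O.
Proof.
elim/powmod_ind: x => A.
by rewrite powmod_complE [LHS]powmod_meetE setICr.
Qed.

HB.instance Definition _ :=
  Order.TBDistrLattice_hasComplement.Build set_display powmod joinxC meetxC.

End PowersetMod.

Definition boolean_iso d1 d2 (A : Order.CTBDistrLattice.type d1)
    (B : Order.CTBDistrLattice.type d2) (alpha : A -> B) : Prop :=
  bijective alpha /\
  [/\ alpha \bot%O = \bot%O, alpha \top%O = \top%O,
      {morph alpha : x y / (x `&` y)%O},
      {morph alpha : x y / (x `|` y)%O} &
      {morph alpha : x / (~` x)%O}].

Section ReducedProduct.
Local Open Scope group_scope.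
Variables (I : Type) (G : I -> groupType).
Implicit Types a b c : forall i, G i.

Definition prodg_mul a b i := a i * b i.
Definition prodg_one i : G i := 1.
Definition prodg_inv a i := (a i)^-1.

Section Quotient.
Variable N : ideal I.

Definition prodg_eqmod : rel (forall i, G i) :=
  fun a b => `[< N [set i | a i <> b i] >].

Lemma prodg_eqmod_refl : reflexive prodg_eqmod.
Proof.
by move=> a; apply/asboolP; apply: idealS (ideal0 N) => i /=.
Qed.

Lemma prodg_eqmod_sym : symmetric prodg_eqmod.
Proof.
move=> a b; apply/asboolP/asboolP; apply: idealS => i /=;
  exact: contra_not.
Qed.

Lemma prodg_eqmod_trans : transitive prodg_eqmod.
Proof.
move=> b a c /asboolP Nab /asboolP Nbc; apply/asboolP.
apply: idealS (idealU Nab Nbc) => i /= ac.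
by have [ab|] := pselect (a i = b i); [right; rewrite -ab|left].
Qed.

Canonical prodg_eqmod_equiv :=
  EquivRel prodg_eqmod prodg_eqmod_refl prodg_eqmod_sym prodg_eqmod_trans.

Definition redprod : Type := {eq_quot prodg_eqmod}.

HB.instance Definition _ := Choice.on redprod.
HB.instance Definition _ := EqQuotient.on redprod.

Definition prodg_class a : redprod := \pi_redprod a.

Lemma prodg_class_repr (x : redprod) : prodg_class (repr x) = x.
Proof. exact: reprK. Qed.

Lemma prodg_classP a b :
  prodg_class a = prodg_class b <-> N [set i | a i <> b i].
Proof.
split=> [/eqmodP /asboolP //|Nab].
by apply/eqmodP; apply/asboolP.
Qed.

Lemma repr_prodg_class a : N [set i | repr (prodg_class a) i <> a i].
Proof. by apply/prodg_classP; rewrite prodg_class_repr. Qed.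

Definition redprod_mul (x y : redprod) :=
  prodg_class (prodg_mul (repr x) (repr y)).
Definition redprod_one := prodg_class prodg_one.
Definition redprod_inv (x : redprod) := prodg_class (prodg_inv (repr x)).

Lemma redprod_mulE a b :
  redprod_mul (prodg_class a) (prodg_class b) = prodg_class (prodg_mul a b).
Proof.
apply/prodg_classP.
apply: idealS (idealU (repr_prodg_class a) (repr_prodg_class b)) => i /=.
rewrite -not_andP; apply: contra_not => -[ea eb].
by rewrite /prodg_mul ea eb.
Qed.

Lemma redprod_invE a : redprod_inv (prodg_class a) = prodg_class (prodg_inv a).
Proof.
apply/prodg_classP; apply: idealS (repr_prodg_class a) => i /=.
by apply: contra_not => ea; rewrite /prodg_inv ea.
Qed.

Lemma redprod_ind (P : redprod -> Prop) :
  (forall a, P (prodg_class a)) -> forall x, P x.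
Proof. by move=> Pa x; rewrite -(prodg_class_repr x). Qed.

Let mulA : associative redprod_mul.
Proof.
elim/redprod_ind=> a; elim/redprod_ind=> b; elim/redprod_ind=> c.
rewrite !redprod_mulE; congr prodg_class.
by apply: functional_extensionality_dep => i; exact: mulgA.
Qed.

Let mul1 : left_id redprod_one redprod_mul.
Proof.
elim/redprod_ind=> a; rewrite redprod_mulE; congr prodg_class.
by apply: functional_extensionality_dep => i; exact: mul1g.
Qed.

Let mulr1 : right_id redprod_one redprod_mul.
Proof.
elim/redprod_ind=> a; rewrite redprod_mulE; congr prodg_class.
by apply: functional_extensionality_dep => i; exact: mulg1.
Qed.

Let mulV : left_inverse redprod_one redprod_inv redprod_mul.
Proof.
elim/redprod_ind=> a; rewrite redprod_invE redprod_mulE; congr prodg_class.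
by apply: functional_extensionality_dep => i; exact: mulVg.
Qed.

Let mulrV : right_inverse redprod_one redprod_inv redprod_mul.
Proof.
elim/redprod_ind=> a; rewrite redprod_invE redprod_mulE; congr prodg_class.
by apply: functional_extensionality_dep => i; exact: mulgV.
Qed.

HB.instance Definition _ :=
  isGroup.Build redprod mulA mul1 mulr1 mulV mulrV.

End Quotient.

(* [redprod (restr_ideal N S)] is the restriction to S: two sequences are
   identified when the indices in S at which they differ form a set in N. *)
Definition redprod_proj (N : ideal I) (S : powmod N) (x : redprod N) :
    redprod (restr_ideal N (repr S)) :=
  prodg_class (restr_ideal N (repr S)) (repr x).

(* In particular [redprod_proj] depends only on the class of S. *)
Lemma redprod_projP (N : ideal I) (S : set I) a b :
  redprod_proj (set_class N S) (prodg_class N a) =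
    redprod_proj (set_class N S) (prodg_class N b) <->
  N ([set i | a i <> b i] `&` S).
Proof.
rewrite /redprod_proj prodg_classP /=.
have Na := repr_prodg_class N a; have Nb := repr_prodg_class N b.
have NS := repr_set_class N S.
split=> Nab; apply: idealS (idealU (idealU Na Nb) (idealU NS Nab)) => i /=;
  move: (pselect (repr (prodg_class N a) i = a i))
        (pselect (repr (prodg_class N b) i = b i)) => [->|?] [->|?];
  have [?|?] := pselect (repr (set_class N S) i);
  have [?|?] := pselect (S i); tauto.
Qed.

End ReducedProduct.

Definition coordinate_respecting (I J : Type) (N : ideal I) (L : ideal J)
    (G : I -> groupType) (H : J -> groupType)
    (Phi : redprod G N -> redprod H L) : Prop :=
  exists2 alpha : powmod N -> powmod L, boolean_iso alpha &
    forall (S : powmod N) (x y : redprod G N),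
      redprod_proj S x = redprod_proj S y ->
      redprod_proj (alpha S) (Phi x) = redprod_proj (alpha S) (Phi y).

Definition recognizes_coordinates (C : groupType -> Prop) : Prop :=
  forall (I J : Type) (N : ideal I) (L : ideal J)
    (G : I -> groupType) (H : J -> groupType),
    proper_ideal N -> proper_ideal L ->
    (forall i, C (G i)) -> (forall j, C (H j)) ->
  forall Phi : {multiplicative redprod G N -> redprod H L},
    bijective Phi -> coordinate_respecting Phi.

(* The set of the groups D k with k in A. It is a predicate rather than an
   element of [set groupType], which universe constraints rule out. *)
Definition groups_of (K : Type) (D : K -> groupType) (A : set K) :
    groupType -> Prop :=
  fun G => exists2 k, A k & G = D k.

Section Groups.
Local Open Scope group_scope.

Definition nontrivial_group (G : groupType) : Prop := exists x : G, x <> 1.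

Definition indecomposable_group (G : groupType) : Prop :=
  ~ exists A B : groupType, [/\ nontrivial_group A, nontrivial_group B &
      exists f : {multiplicative G -> (A * B)%type}, bijective f].

Definition is_subgroup (G : groupType) (H : set G) : Prop :=
  [/\ H 1, forall x y, H x -> H y -> H (x * y) & forall x, H x -> H x^-1].

Definition commutator_subgroup (G : groupType) : set G :=
  smallest (@is_subgroup G) [set z | exists x y : G, z = [~ x, y]].
#[global] Arguments commutator_subgroup : clear implicits.

Definition perfect_group (G : groupType) : Prop :=
  commutator_subgroup G = setT.

Definition group_center (G : groupType) : set G :=
  [set z | forall x, commute z x].
#[global] Arguments group_center : clear implicits.

End Groups.

(* Main.v *)
From HB Require Import structures.
From mathcomp Require Import all_boot all_order all_fingroup all_algebra.
From mathcomp Require Import generic_quotient.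
From mathcomp Require Import boolp classical_sets functions cardinality.
Require Import Defs.

(* The family consists of the finite groups [blockg n] of block matrices
     [[1, x, z], [0, s, y], [0, 0, 1]]
   over F_2 with blocks of sizes n, 3, n, where s runs through the group
   generated by the transvections of size 3. The corner z is additive up to
   matrices of rank at most 3, so in the full product of these groups the
   sequences whose corners have bounded rank form a subgroup containing all
   squares. It is proper, so Zorn's lemma gives a nontrivial morphism h from the
   product to Z/2 killing all sequences supported on finitely many coordinates.
   Twisting one coordinate by a central involution according to h is an
   automorphism that does not respect coordinates.

   For finitely many finite perfect groups every reduced product M is perfect.
   Two projections of a perfect group onto direct factors commute: both
   composites send a commutator [~ x, y] to [~ e x, e' y]. So every such
   projection of M commutes with the restrictions to sets of coordinates, hence
   acts coordinatewise, almost everywhere through direct projections of the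
   factors. These are indecomposable, so the direct factors of M are exactly the
   restrictions to sets of coordinates, which any isomorphism must permute. *)

Set Implicit Arguments.
Unset Strict Implicit.
Unset Printing Implicit Defensive.

Import GRing.Theory.
Local Open Scope classical_set_scope.
Local Open Scope group_scope.

(** * Perfect groups and direct projections *)

(* The library's [invgM] leaves behind structure terms that block later
   rewriting. *)
Lemma group_invM (G : groupType) (x y : G) : (x * y)^-1 = y^-1 * x^-1.
Proof. exact: invgM. Qed.

Section Morphisms.
Variables (G H : groupType) (f : G -> H).
Hypothesis fM : {morph f : x y / x * y}.

Lemma morph_one : f 1 = 1.
Proof. by apply: (@mulgI H (f 1)); rewrite -fM !mulg1. Qed.

Lemma morph_inv : {morph f : x / x^-1}.
Proof. by move=> x; apply: (@mulgI H (f x)); rewrite -fM !mulgV morph_one. Qed.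

Lemma morph_commg : {morph f : x y / [~ x, y]}.
Proof. by move=> x y; rewrite /commg /conjg !fM !morph_inv. Qed.

(** The preimage of [Q] is a subgroup containing every commutator, hence everything. Perfection is
    mostly used in this form. *)
Lemma perfect_morph_sub (Q : set H) : perfect_group G -> is_subgroup Q ->
  (forall x y, Q [~ f x, f y]) -> forall x, Q (f x).
Proof.
move=> pG [Q1 QM QV] QR x.
have : commutator_subgroup G x by rewrite pG.
move=> /(_ [set y | Q (f y)]); apply; split; last first.
  by move=> _ [y [z ->]] /=; rewrite morph_commg.
split=> [|y z Qy Qz|y Qy]; first by rewrite /= morph_one.
- by rewrite /= fM; exact: QM.
- by rewrite /= morph_inv; exact: QV.
Qed.

Lemma perfect_morph_commute : perfect_group G ->
  (forall x y, commute (f x) (f y)) -> forall x, f x = 1.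
Proof.
move=> pG cf; apply: (@perfect_morph_sub [set 1]) => //=.
- by split=> [//|_ _ -> ->|_ ->]; rewrite ?mulg1 ?invg1.
- by move=> x y; apply/eqP/commgP.
Qed.

End Morphisms.

Lemma perfect_morph_eq (G H : groupType) (f g : G -> H) :
  perfect_group G -> {morph f : x y / x * y} -> {morph g : x y / x * y} ->
  (forall x y, f [~ x, y] = g [~ x, y]) -> f =1 g.
Proof.
move=> pG fM gM fg x.
apply: (@perfect_morph_sub G G id _ [set x | f x = g x]) => //.
split=> [|y z /= fgy fgz|y /= fgy]; first by rewrite /= !morph_one.
- by rewrite fM gM fgy fgz.
- by rewrite !morph_inv // fgy.
Qed.

(** Since [(e y)^-1 * y] runs through the kernel of [e], these are the projections of internal
    decompositions G = im e × ker e. Direct factors thus become endomorphisms, which can be composed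
    and compared. *)
Definition direct_projection (G : groupType) (e : G -> G) : Prop :=
  [/\ {morph e : x y / x * y}, forall x, e (e x) = e x &
      forall x y, commute (e x) ((e y)^-1 * y)].

Definition only_trivial_projections (G : groupType) : Prop :=
  forall e : G -> G, direct_projection e -> e =1 id \/ (forall x, e x = 1).

Section DirectProjection.
Variables (G : groupType) (e : G -> G).
Hypothesis pe : direct_projection e.

(** In y = e(y) · (e(y)^-1 y) the second factor commutes with the image of [e], so [y] and [e y] act
    on that image by the same conjugation. *)
Lemma direct_projection_conjg x y : e x ^ y = e (x ^ y).
Proof.
have [eM _ ec] := pe.
rewrite -{1}(mulVKg (e y) y) conjgM.
have -> : e x ^ e y = e (x ^ y) by rewrite /conjg !eM morph_inv.
by apply/conjg_fixP/commgP; exact: ec.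
Qed.

Lemma direct_projection_commgl x y : e [~ x, y] = [~ e x, y].
Proof.
have [eM _ _] := pe.
by rewrite !commgEl direct_projection_conjg eM morph_inv.
Qed.

Lemma direct_projection_commgr x y : e [~ x, y] = [~ x, e y].
Proof.
have [eM _ _] := pe.
by rewrite -[LHS]invgK -(morph_inv eM) invgR direct_projection_commgl invgR.
Qed.

(** The projection onto the other factor; it exchanges the cases of identity and trivial
    projection. *)
Lemma direct_projection_compl : direct_projection (fun x => (e x)^-1 * x).
Proof.
have [eM ei ec] := pe; split=> [x y|x|x y].
- have cu : commute (e y)^-1 ((e x)^-1 * x).
    exact/commute_sym/commuteV/commute_sym/ec.
  by rewrite eM group_invM (mulgA _ x) -(mulgA _ _ x) cu -mulgA.
- by rewrite eM morph_inv // ei mulVg invg1 mul1g.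
- have ->: ((e y)^-1 * y)^-1 * y = e y.
    rewrite group_invM invgK -mulgA.
    have : commute (e y) y.
      by rewrite -{2}(mulVKg (e y) y); apply: commuteM => //; exact: ec.
    by move=> ->; rewrite mulKg.
  exact/commute_sym/ec.
Qed.

End DirectProjection.

Lemma direct_projectionC (G : groupType) (e e' : G -> G) : perfect_group G ->
  direct_projection e -> direct_projection e' -> forall x, e (e' x) = e' (e x).
Proof.
move=> pG pe pe'; have [eM _ _] := pe; have [eM' _ _] := pe'.
apply: perfect_morph_eq => // x y; first by rewrite eM' eM.
  by rewrite eM eM'.
rewrite (direct_projection_commgr pe') (direct_projection_commgl pe).
by rewrite (direct_projection_commgl pe) (direct_projection_commgr pe').
Qed.

(** The projection onto [A] is transported to [G]: if it is the identity then [B] is trivial, if it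
    is constant then [A] is. *)
Lemma only_trivial_projections_indecomposable (G : groupType) :
  only_trivial_projections G -> indecomposable_group G.
Proof.
move=> trivG [A [B [[a a1] [b b1] [f [g fK gK]]]]].
have gM : {morph g : x y / x * y} by exact: can2_gmulfM fK gK.
pose e x := g ((f x).1, 1).
have pe : direct_projection e.
  split=> [x y|x|x y]; rewrite /e ?gK //.
    by rewrite -gM gmulfM /=; congr g; congr pair; rewrite mul1g.
  apply: (can_inj fK); rewrite !gmulfM (morph_inv (@gmulfM _ _ f)) !gK.
  by congr pair; rewrite /= ?mulVg ?invg1 ?mul1g ?mulg1.
have [/(_ (g (1, b)))|/(_ (g (a, 1)))] := trivG e pe.
  by rewrite /e gK /= => /(can_inj gK) [] /esym.
by rewrite /e gK /= -(morph_one gM) => /(can_inj gK) [].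
Qed.

(** * Restrictions of reduced products *)

Section Masks.
Variables (I : Type) (G : I -> groupType) (N : ideal I).
Implicit Types (S T : set I) (a b : forall i, G i) (x y : redprod G N).

(** Extension by 1 realizes restriction to [S] inside the product itself, where it is a direct
    projection. *)
Definition mask S a : forall i, G i := fun i => if `[< S i >] then a i else 1.

Definition redprod_mask S x : redprod G N := prodg_class N (mask S (repr x)).

Lemma prodg_classM a b :
  prodg_class N a * prodg_class N b = prodg_class N (prodg_mul a b).
Proof. exact: redprod_mulE. Qed.

Lemma prodg_classV a : (prodg_class N a)^-1 = prodg_class N (prodg_inv a).
Proof. exact: redprod_invE. Qed.

Lemma prodg_class_ae (B : set I) a b : N B ->
  (forall i, ~ B i -> a i = b i) -> prodg_class N a = prodg_class N b.
Proof.
move=> NB ab; apply/prodg_classP; apply: idealS NB => i /= abi.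
by apply: contrapT => /ab.
Qed.

Lemma redprod_maskE S a :
  redprod_mask S (prodg_class N a) = prodg_class N (mask S a).
Proof.
apply: prodg_class_ae (repr_prodg_class N a) _ => i /= /contrapT.
by rewrite /mask => ->.
Qed.

Lemma mask_in S a i : S i -> mask S a i = a i.
Proof. by move=> Si; rewrite /mask asboolT. Qed.

Lemma mask_out S a i : ~ S i -> mask S a i = 1.
Proof. by move=> Si; rewrite /mask asboolF. Qed.

Lemma redprod_mask_eqP S a b :
  redprod_mask S (prodg_class N a) = redprod_mask S (prodg_class N b) <->
  N ([set i | a i <> b i] `&` S).
Proof.
rewrite !redprod_maskE prodg_classP; split; apply: idealS => i /=.
  by move=> [abi Si]; rewrite !mask_in.
have [Si|Si] := pselect (S i); first by rewrite !mask_in.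
by rewrite !mask_out.
Qed.

Lemma redprod_mask_class S x :
  redprod_mask (repr (set_class N S)) x = redprod_mask S x.
Proof.
elim/redprod_ind: x => a; rewrite !redprod_maskE.
apply: prodg_class_ae (repr_set_class N S) _ => i /=.
rewrite /mask => nY; congr (if _ then _ else _); apply/asbool_equiv_eq.
by split=> Si; apply: contrapT => nSi; apply: nY; tauto.
Qed.

Lemma redprod_proj_mask (S : powmod N) x y :
  redprod_proj S x = redprod_proj S y <->
  redprod_mask (repr S) x = redprod_mask (repr S) y.
Proof.
elim/powmod_ind: S => S; elim/redprod_ind: x => a; elim/redprod_ind: y => b.
by rewrite !redprod_mask_class redprod_projP redprod_mask_eqP.
Qed.

Lemma redprod_mask_proj S : direct_projection (redprod_mask S).
Proof.
split.
- elim/redprod_ind=> a; elim/redprod_ind=> b.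
  rewrite prodg_classM !redprod_maskE prodg_classM; congr prodg_class.
  by apply: functional_extensionality_dep => i;
    rewrite /mask /prodg_mul; case: ifP; rewrite ?mulg1.
- elim/redprod_ind=> a; rewrite !redprod_maskE; congr prodg_class.
  by apply: functional_extensionality_dep => i; rewrite /mask; case: asbool.
- elim/redprod_ind=> a; elim/redprod_ind=> b.
  rewrite !redprod_maskE prodg_classV /commute (prodg_classM (prodg_inv _)).
  rewrite !prodg_classM; congr prodg_class.
  apply: functional_extensionality_dep => i; rewrite /mask /prodg_mul /prodg_inv.
  by case: asbool; rewrite ?mulVg ?mul1g ?mulg1.
Qed.

Lemma redprod_maskM S : {morph redprod_mask S : x y / x * y}.
Proof. by have [] := redprod_mask_proj S. Qed.

Lemma redprod_maskI S T x :
  redprod_mask S (redprod_mask T x) = redprod_mask (S `&` T) x.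
Proof.
elim/redprod_ind: x => a; rewrite !redprod_maskE; congr prodg_class.
apply: functional_extensionality_dep => i.
have [Si|Si] := pselect (S i); have [Ti|Ti] := pselect (T i);
  by rewrite /mask ?(asboolT Si) ?(asboolT Ti) ?(asboolF Si) ?(asboolF Ti) //=;
     case: asboolP => // -[].
Qed.

Lemma redprod_maskC S x : redprod_mask (~` S) x = (redprod_mask S x)^-1 * x.
Proof.
elim/redprod_ind: x => a; rewrite !redprod_maskE prodg_classV prodg_classM.
congr prodg_class; apply: functional_extensionality_dep => i.
rewrite /prodg_mul /prodg_inv; have [Si|Si] := pselect (S i).
  by rewrite mask_out ?mask_in ?mulVg // => /(_ Si).
by rewrite mask_in ?mask_out ?invg1 ?mul1g.
Qed.

Lemma redprod_maskT x : redprod_mask setT x = x.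
Proof.
elim/redprod_ind: x => a; rewrite !redprod_maskE; congr prodg_class.
by apply: functional_extensionality_dep => i; rewrite mask_in.
Qed.

(** Both masks are tested on a sequence with no entry equal to 1. *)
Lemma redprod_mask_inj S T : (forall i, nontrivial_group (G i)) ->
  redprod_mask S =1 redprod_mask T -> N (S `+` T).
Proof.
move=> ntG; pose w i := sval (cid (ntG i)).
have w1 i : w i <> 1 := svalP (cid (ntG i)).
move=> /(_ (prodg_class N w)).
rewrite !redprod_maskE prodg_classP; apply: idealS => i /=.
move=> [[Si Ti]|[Ti Si]]; first by rewrite (mask_in _ Si) mask_out.
by rewrite (mask_in _ Ti) mask_out // => /esym; exact: w1.
Qed.

End Masks.

(** * Finite families of finite groups *)

Lemma ideal_bigcup_finite (I : Type) (N : ideal I) (U : choiceType)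
    (E : set U) (F : U -> set I) :
  finite_set E -> (forall u, E u -> N (F u)) -> N (\bigcup_(u in E) F u).
Proof.
move=> /finite_seqP [s ->]; elim: s => [|u s IHs] NF.
  by apply: idealS (ideal0 N) => i [].
have NFs : N (\bigcup_(v in [set` s]) F v).
  by apply: IHs => v /= vs; apply: NF; rewrite /= inE vs orbT.
apply: idealS (idealU (NF u _) NFs); last by rewrite /= inE eqxx.
move=> i [v /=]; rewrite inE => /orP[/eqP->|vs] Fi; [by left|right].
by exists v.
Qed.

(** A counterexample chosen at each bad index yields two sequences that violate [P] at all bad
    indices at once. *)
Lemma ideal_ae_forall (I : Type) (N : ideal I) (G : I -> groupType)
    (P : forall i, G i -> G i -> Prop) :
  (forall a b : forall i, G i, N [set i | ~ P i (a i) (b i)]) ->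
  N [set i | ~ forall g h, P i g h].
Proof.
move=> NP.
pose bad i (gh : G i * G i) := ~ P i gh.1 gh.2.
pose w i : G i * G i :=
  if pselect (exists gh, bad i gh) is left ex then sval (cid ex) else (1, 1).
have badw i : (exists gh, bad i gh) -> bad i (w i).
  by rewrite /w => ex; case: pselect => // ex'; exact: svalP (cid ex').
apply: idealS (NP (fun i => (w i).1) (fun i => (w i).2)) => i /= nP.
apply: (badw i); apply: contrapT => nbad; apply: nP => g h.
by apply: contrapT => nPgh; apply: nbad; exists (g, h).
Qed.

Section FiniteFamily.
Import Order.Theory.

Variables (K : choiceType) (D : K -> groupType) (A : set K).
Hypothesis finA : finite_set A.
Hypothesis finD : forall k, finite_set [set: D k].
Hypothesis perfD : forall k, perfect_group (D k).
Hypothesis trivD : forall k, only_trivial_projections (D k).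

Section Factors.
Variables (I : Type) (N : ideal I) (kap : I -> K).
Hypothesis Akap : forall i, A (kap i).

Let G i := D (kap i).
Let M := redprod G N.

(** A substitute for constant sequences when the factors vary: the equality of labels carries [g]
    into the factor. *)
Definition const_at (k : K) (g : D k) : forall i, G i := fun i =>
  if pselect (k = kap i) is left e then eq_rect k D g (kap i) e else 1.

Lemma const_atE i (g : D (kap i)) : const_at g i = g.
Proof.
rewrite /const_at; case: pselect => // e.
by rewrite (Prop_irrelevance e erefl).
Qed.

Lemma const_atM k : {morph @const_at k : g h / g * h >-> prodg_mul g h}.
Proof.
move=> g h; apply: functional_extensionality_dep => i.
rewrite /prodg_mul /const_at /G; case: pselect => [e|_]; last by rewrite mulg1.
by move: (kap i) e => l e; case: _ / e.
Qed.

(** Tagging entries with their labels lets entries of different factors be compared and counted. *)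
Let value (a : forall i, G i) i : {k & D k} := existT _ (kap i) (a i).

Let finE : finite_set [set u : {k & D k} | A (tag u)].
Proof.
have -> : [set u : {k & D k} | A (tag u)] =
    \bigcup_(k in A) (existT (fun k => D k) k @` setT).
  apply/seteqP; split=> [[k g] /= Ak|_ [k Ak [g _ <-]] //].
  by exists k => //; exists g.
by apply: bigcup_finite => // k _; exact: finite_image.
Qed.

Let mask_value a S (u : {k & D k}) : (forall i, S i -> value a i = u) ->
  mask S a = mask S (const_at (tagged u)).
Proof.
move=> Su; apply: functional_extensionality_dep => i.
have [Si|Si] := pselect (S i); last by rewrite !mask_out.
by rewrite !mask_in // -(Su i Si) const_atE.
Qed.

(** A sequence has finitely many tagged values, so it is a finite product of masked constants. *)
Lemma redprod_finite_gen (Q : set M) : is_subgroup Q ->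
  (forall S k (g : D k), Q (redprod_mask S (prodg_class N (const_at g)))) ->
  forall x, Q x.
Proof.
move=> [Q1 QM _] Qc; have /finite_seqP [s Es] := finE.
(* The claim is generalized to sequences whose values on [S] lie in a list, for induction on that
   list. *)
suff Qs (t : seq {k & D k}) a S : (forall i, S i -> value a i \in t) ->
    Q (prodg_class N (mask S a)).
  elim/redprod_ind=> a; rewrite -(redprod_maskT (prodg_class N a)) redprod_maskE.
  apply: (Qs s a setT) => i _.
  have : [set` s] (value a i) by rewrite -Es; exact: Akap.
  by [].
elim: t S => [|u t IHt] S St.
  rewrite (_ : mask S a = prodg_one G); first exact: Q1.
  by apply: functional_extensionality_dep => i; rewrite mask_out // => /St.
pose Su := S `&` [set i | value a i = u].
have -> : prodg_class N (mask S a) =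
    prodg_class N (mask Su a) * prodg_class N (mask (S `\` Su) a).
  rewrite prodg_classM; congr prodg_class.
  apply: functional_extensionality_dep => i; rewrite /prodg_mul.
  have [Si|Si] := pselect (S i); last first.
    by rewrite !mask_out ?mulg1 // => -[].
  rewrite (mask_in _ Si); have [ui|ui] := pselect (value a i = u).
    by rewrite mask_in ?mask_out ?mulg1 // => -[_]; apply.
  have Di : (S `\` Su) i by split=> // -[].
  by rewrite (mask_in _ Di) mask_out ?mul1g // => -[].
apply: QM; last first.
  apply: IHt => i [Si nSui]; have := St i Si; rewrite inE => /orP[/eqP ui|//].
  by case: nSui.
by rewrite (@mask_value a Su u) => [|i []//]; rewrite -redprod_maskE.
Qed.

(** For fixed [S] and [k] the masked constants form a homomorphic image of the perfect group [D k],
    so they are products of commutators. *)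
Lemma redprod_finite_perfect : perfect_group M.
Proof.
apply/seteqP; split=> // x _; move: x; apply: redprod_finite_gen.
  split=> [|x y Cx Cy|x Cx] H HM; first by case: HM => -[].
    by have [[_ hM _] _] := HM; apply: hM; [exact: Cx|exact: Cy].
  by have [[_ _ hV] _] := HM; apply: hV; exact: Cx.
move=> S k; apply: perfect_morph_sub => // [g h||g h].
- by rewrite const_atM -prodg_classM redprod_maskM.
- split=> [|x y Cx Cy|x Cx] H HM; first by case: HM => -[].
    by have [[_ hM _] _] := HM; apply: hM; [exact: Cx|exact: Cy].
  by have [[_ _ hV] _] := HM; apply: hV; exact: Cx.
- by move=> H [_]; apply; do 2!eexists.
Qed.

Lemma direct_projection_mask (p : M -> M) : direct_projection p ->
  exists T : set I, p =1 redprod_mask T.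
Proof.
(* [p] commutes with all masks, and every sequence is a finite combination of
   masked constants, so [p] acts coordinatewise through maps [e i]; almost all
   of these are direct projections of [G i], hence trivial. *)
move=> pp.
have pC S x : p (redprod_mask S x) = redprod_mask S (p x).
  apply: direct_projectionC => //; first exact: redprod_finite_perfect.
  exact: redprod_mask_proj.
(* This depends on the chosen representative, so it is meaningful only up to a set in [N]. *)
pose e i (g : G i) : G i := repr (p (prodg_class N (const_at g))) i.
have pE a : p (prodg_class N a) = prodg_class N (fun i => e i (a i)).
  pose R (u : {k & D k}) := repr (p (prodg_class N (const_at (tagged u)))).
  pose F u := [set i | repr (p (prodg_class N a)) i <> R u i]
    `&` [set i | value a i = u].
  (* Where [a] takes the value [u] it agrees with a constant, and [p] commutes with the mask of that
     set. *)
  have NF u : N (F u).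
    apply/redprod_mask_eqP; rewrite !prodg_class_repr -!pC !redprod_maskE.
    by rewrite (@mask_value a _ u).
  rewrite -[LHS]prodg_class_repr.
  apply: prodg_class_ae (ideal_bigcup_finite finE (fun u _ => NF u)) _ => i nF.
  apply: contrapT => ne; apply: nF; exists (value a i); first exact: Akap.
  by split.
have [pM pi pc] := pp.
have NM : N [set i | ~ {morph e i : g h / g * h}].
  apply: (@ideal_ae_forall _ N G (fun i g h => e i (g * h) = e i g * e i h)).
  move=> a b; apply/prodg_classP; have := pM (prodg_class N a) (prodg_class N b).
  by rewrite prodg_classM !pE prodg_classM.
have Ni : N [set i | ~ forall g _ : G i, e i (e i g) = e i g].
  by apply: ideal_ae_forall => a _; apply/prodg_classP;
    have := pi (prodg_class N a); rewrite !pE.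
have Nc : N [set i | ~ forall g h, commute (e i g) ((e i h)^-1 * h)].
  apply: ideal_ae_forall => a b; apply/prodg_classP.
  have := pc (prodg_class N a) (prodg_class N b).
  rewrite !pE prodg_classV (prodg_classM _ (prodg_inv _)) /commute.
  by rewrite !prodg_classM.
exists [set i | e i =1 id]; elim/redprod_ind=> a; rewrite pE redprod_maskE.
apply: prodg_class_ae (idealU NM (idealU Ni Nc)) _ => i nB.
have pei : direct_projection (e i).
  split=> [|g|]; apply: contrapT => h; apply: nB; first by left.
    by right; left => /(_ g g).
  by right; right.
have [ei|ei] := trivD pei; first by rewrite mask_in // ei.
(* If the factor is trivial, [e i] is both constant and the identity, and [i] lies in the mask. *)
have [eid|eid] := pselect (e i =1 id); first by rewrite mask_in // eid.
by rewrite mask_out // ei.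
Qed.

End Factors.

Hypothesis ntD : forall k, nontrivial_group (D k).

Lemma powmod_mask_inj (I : Type) (N : ideal I) (kap : I -> K) (s t : powmod N) :
  (forall x : redprod (fun i => D (kap i)) N,
     redprod_mask (repr s) x = redprod_mask (repr t) x) -> s = t.
Proof.
move=> st; rewrite -(set_class_repr s) -(set_class_repr t); apply/set_classP.
exact: redprod_mask_inj st.
Qed.

Lemma direct_projection_transport (G H : groupType) (f : G -> H) (g : H -> G)
    (e : G -> G) : {morph f : x y / x * y} -> cancel f g -> cancel g f ->
  direct_projection e -> direct_projection (fun y => f (e (g y))).
Proof.
move=> fM fK gK [eM ei ec].
have gM : {morph g : x y / x * y}.
  by move=> x y; apply: (can_inj fK); rewrite fM !gK.
split=> [x y|x|x y]; rewrite ?gM ?eM ?fM ?fK ?ei //.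
rewrite -morph_inv // -{2}(gK y) -fM /commute -!fM; congr f; exact: ec.
Qed.

(** Conjugating a mask by [f] gives a direct projection of the target, which is again a mask. *)
Lemma mask_transport (I J : Type) (N : ideal I) (L : ideal J)
    (G : I -> groupType) (mu : J -> K)
    (f : redprod G N -> redprod (fun j => D (mu j)) L)
    (g : redprod (fun j => D (mu j)) L -> redprod G N) :
  (forall j, A (mu j)) -> {morph f : x y / x * y} -> cancel f g -> cancel g f ->
  exists a : powmod N -> powmod L, forall s x,
    f (redprod_mask (repr s) x) = redprod_mask (repr (a s)) (f x).
Proof.
move=> Amu fM fK gK.
have ex (s : powmod N) : exists t : powmod L, forall x,
    f (redprod_mask (repr s) x) = redprod_mask (repr t) (f x).
  have := direct_projection_transport fM fK gK (redprod_mask_proj G N (repr s)).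
  move=> /(direct_projection_mask Amu) [T fT].
  by exists (set_class L T) => x; rewrite redprod_mask_class -fT fK.
by have [a aP] := choice ex; exists a.
Qed.

(** A class is determined by its mask, so the Boolean identities for [a] are checked on masks; [b],
    obtained from the inverse of [f], inverts [a]. *)
Lemma finite_coordinate_respecting (I J : Type) (N : ideal I) (L : ideal J)
    (kap : I -> K) (mu : J -> K)
    (f : redprod (fun i => D (kap i)) N -> redprod (fun j => D (mu j)) L) :
  (forall i, A (kap i)) -> (forall j, A (mu j)) ->
  {morph f : x y / x * y} -> bijective f -> coordinate_respecting f.
Proof.
move=> Akap Amu fM [g fK gK].
have gM : {morph g : x y / x * y}.
  by move=> x y; apply: (can_inj fK); rewrite fM !gK.
have [a aP] := mask_transport Amu fM fK gK.
have [b bP] := mask_transport Akap gM gK fK.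
have aI : {morph a : s t / (s `&` t)%O}.
  move=> s t; apply: (@powmod_mask_inj _ _ mu) => y; rewrite -(gK y) -aP.
  by rewrite !redprod_mask_class -!redprod_maskI !aP.
have aC : {morph a : s / (~` s)%O}.
  move=> s; apply: (@powmod_mask_inj _ _ mu) => y; rewrite -(gK y) -aP.
  by rewrite !redprod_mask_class !redprod_maskC fM morph_inv // aP.
have aU : {morph a : s t / (s `|` t)%O}.
  by move=> s t; rewrite -[(s `|` t)%O]complK complU aC aI !aC
    -complU complK.
have a0 : a \bot%O = \bot%O.
  by rewrite -[in LHS](meetxC (\bot%O : powmod N)) aI aC meetxC.
exists a => [|s x y].
  split; last first.
    split=> //; first by rewrite -compl0 aC a0 compl0.
  exists b => s.
    apply: (@powmod_mask_inj _ _ kap) => x.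
    by rewrite -{1}(fK x) -bP -aP fK.
  apply: (@powmod_mask_inj _ _ mu) => y.
  by rewrite -{1}(gK y) -aP -bP gK.
by rewrite !redprod_proj_mask -!aP => ->.
Qed.

Theorem finite_family_recognizes_coordinates :
  recognizes_coordinates (groups_of D A).
Proof.
move=> I J N L G H _ _ CG CH.
have /choice [kap kapP] i : exists k, A k /\ G i = D k.
  by have [k Ak ->] := CG i; exists k.
have /choice [mu muP] j : exists k, A k /\ H j = D k.
  by have [k Ak ->] := CH j; exists k.
have -> : G = fun i => D (kap i) by apply/funext => i; have [] := kapP i.
have -> : H = fun j => D (mu j) by apply/funext => j; have [] := muP j.
move=> Phi bPhi; apply: finite_coordinate_respecting bPhi.
- by move=> i; have [] := kapP i.
- by move=> j; have [] := muP j.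
- exact: gmulfM.
Qed.

End FiniteFamily.

(** * Transvections over F_2 *)

Lemma F2_addrr (x : 'F_2) : (x + x = 0)%R.
Proof. by case: x => -[|[|m]] ltm //; exact: val_inj. Qed.

Lemma F2_cases (x : 'F_2) : x = 0%R \/ x = 1%R.
Proof. by case: x => -[|[|m]] ltm //; [left|right]; exact: val_inj. Qed.

Lemma third_index (i j : 'I_3) : exists2 k : 'I_3, k != i & k != j.
Proof.
have : (0 < #|~: [set i; j]%SET|)%N.
  by rewrite cardsCs finset.setCK card_ord cards2; case: (i != j).
by case/card_gt0P=> k; rewrite !inE negb_or => /andP[ki kj]; exists k.
Qed.

Section Transvections.
Implicit Types (i j k l : 'I_3) (A B : 'M['F_2]_3).

Local Open Scope ring_scope.

Definition transvection_mx i j : 'M['F_2]_3 := 1 + delta_mx i j.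

Lemma mul_delta_mx3 i j k l :
  delta_mx i j * delta_mx k l = delta_mx i l *+ (j == k) :> 'M['F_2]_3.
Proof. exact: mul_delta_mx_cond. Qed.

Lemma transvection_mxK i j : i != j ->
  transvection_mx i j * transvection_mx i j = 1.
Proof.
move=> ij; rewrite /transvection_mx mulrDl mul1r mulrDr mulr1 mul_delta_mx3.
rewrite eq_sym (negPf ij) addr0 -addrA.
suff -> : delta_mx i j + delta_mx i j = 0 :> 'M['F_2]_3 by rewrite addr0.
by apply/matrixP => r c; rewrite !mxE F2_addrr.
Qed.

Lemma transvection_mx_unit i j : i != j -> transvection_mx i j \is a GRing.unit.
Proof.
by move=> ij; apply/unitrP; exists (transvection_mx i j); rewrite transvection_mxK.
Qed.

(** The Steinberg relation [t_ij, t_jk] = t_ik, cleared of inverses. *)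
Lemma transvection_mx_comm i j k : i != j -> i != k ->
  transvection_mx i j * transvection_mx j k =
  transvection_mx j k * transvection_mx i j * transvection_mx i k.
Proof.
move=> ij ik; rewrite /transvection_mx !(mulrDl, mulrDr, mul1r, mulr1).
rewrite !mul_delta_mx3 !(eq_sym k) (negPf ik) eqxx (eq_sym j i) (negPf ij).
rewrite !(mulr0n, mulr1n, mul0r, mulr0, addr0).
by rewrite !addrA (addrAC 1).
Qed.

(** [A] commutes with E_kl, and A E_kl carries column k of [A] in column l, while E_kl A carries row
    l of [A] in row k. *)
Lemma comm_transvection_mx A k l :
  A * transvection_mx k l = transvection_mx k l * A ->
  [/\ forall r, r != k -> A r k = 0, forall c, c != l -> A l c = 0 &
      A k k = A l l].
Proof.
rewrite /transvection_mx mulrDl mulrDr mul1r mulr1 => /addrI /matrixP eqA.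
have eqA' r c : A r k *+ (c == l) = A l c *+ (r == k).
  have := eqA r c; rewrite !mxE (bigD1 k) //= [in RHS](bigD1 l) //= !mxE !eqxx /=.
  rewrite !big1 => [|s /negPf sl|s /negPf sk];
    rewrite ?mxE ?sl ?sk ?andbF ?mul0r ?mulr0 //.
  by rewrite !addr0 mulr_natr mulr_natl andbT.
split=> [r /negPf rk|c /negPf cl|].
- by have := eqA' r l; rewrite eqxx rk.
- by have := eqA' k c; rewrite eqxx cl.
- by have := eqA' k l; rewrite !eqxx.
Qed.

(** The listed transvections are those commuting with t_ij, so this is a double centralizer. The
    pairs (c, j) and (i, l) already kill all off-diagonal entries but (i, j) and make the diagonal
    constant. *)
Lemma comm_comm_transvection_mx A i j : i != j -> A \is a GRing.unit ->
  (forall k l, k != l -> k != j -> l != i ->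
     A * transvection_mx k l = transvection_mx k l * A) ->
  A = 1 \/ A = transvection_mx i j.
Proof.
move=> ij uA cA.
have col c r : c != j -> r != c -> A r c = 0.
  move=> cj rc; have ji : j != i by rewrite eq_sym.
  by have [h _ _] := comm_transvection_mx (cA c j cj cj ji); exact: h.
have row l c : l != i -> c != l -> A l c = 0.
  move=> li cl; have il : i != l by rewrite eq_sym.
  by have [_ h _] := comm_transvection_mx (cA i l il ij li); exact: h.
have diag c : A c c = A j j.
  have [->//|cj] := eqVneq c j; have ji : j != i by rewrite eq_sym.
  by have [_ _ h] := comm_transvection_mx (cA c j cj cj ji).
have AE : A = (A j j)%:M + A i j *: delta_mx i j.
  apply/matrixP => r c; rewrite !mxE; have [->|rc] := eqVneq r c.
    rewrite diag; have [->|ci] := eqVneq c i; last by rewrite mulr0 addr0.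
    by rewrite (negPf ij) mulr0 addr0.
  rewrite add0r; case: (eqVneq c j) rc => [-> rj|cj rc]; last first.
    by rewrite andbF mulr0 col.
  have [->|ri] := eqVneq r i; first by rewrite mulr1.
  by rewrite mulr0 row // eq_sym.
have Ajj : A j j = 1.
  (* With zero diagonal [A] is a multiple of E_ij, so it squares to zero and is not invertible. *)
  case: (F2_cases (A j j)) => // Ajj.
  have AA : A * A = 0.
    rewrite AE Ajj raddf0 add0r -scalerAl -scalerAr mul_delta_mx3 eq_sym (negPf ij).
    by rewrite !scaler0.
  have : (A * A) \is a GRing.unit by rewrite unitrMl.
  by rewrite AA unitr0.
rewrite AE Ajj; case: (F2_cases (A i j)) => ->; [left|right].
  by rewrite scale0r addr0.
by rewrite scale1r.
Qed.

End Transvections.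

(** * The group generated by the transvections of size 3 *)

Definition transvection (i j : 'I_3) : {unit 'M['F_2]_3} :=
  insubd (1 : {unit 'M['F_2]_3}) (transvection_mx i j).

Lemma val_transvection i j : i != j ->
  val (transvection i j) = transvection_mx i j.
Proof. by move=> ij; rewrite val_insubd transvection_mx_unit. Qed.

Definition elementary_group : {group {unit 'M['F_2]_3}} :=
  <<[set transvection p.1 p.2 | p in [set p : 'I_3 * 'I_3 | p.1 != p.2]]%SET>>%G.

Definition elemg : finGroupType := subg_of elementary_group.

Definition elem_mx (s : elemg) : 'M['F_2]_3 := val (sgval s).

Lemma elem_mxM s t : elem_mx (s * t) = (elem_mx s *m elem_mx t)%R.
Proof. by []. Qed.

Lemma elem_mx1 : elem_mx 1 = 1%:M%R.
Proof. by []. Qed.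

Lemma elem_mx_unit s : elem_mx s \is a GRing.unit.
Proof. exact: valP. Qed.

Lemma elem_mx_inj : injective elem_mx.
Proof. by move=> s t /val_inj /val_inj. Qed.

Lemma elem_mul_eq s t u :
  (elem_mx s *m elem_mx t = elem_mx t *m elem_mx s *m elem_mx u)%R ->
  s * t = t * s * u.
Proof. by rewrite -!elem_mxM => /elem_mx_inj. Qed.

Lemma elem_commute s t :
  commute s t <-> (elem_mx s *m elem_mx t = elem_mx t *m elem_mx s)%R.
Proof. by rewrite -!elem_mxM; split=> [->//|/elem_mx_inj]. Qed.

Lemma transvection_in i j : i != j -> transvection i j \in elementary_group.
Proof.
move=> ij; apply: mem_gen; apply/imsetP; exists (i, j) => //.
by rewrite inE.
Qed.

(* Sealed, because unification of two transvections would otherwise evaluate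
   [subg]. *)
Lemma tv_sealed : {f : 'I_3 -> 'I_3 -> elemg |
  forall i j, f i j = subg elementary_group (transvection i j)}.
Proof. by exists (fun i j => subg elementary_group (transvection i j)). Qed.

Definition tv : 'I_3 -> 'I_3 -> elemg := sval tv_sealed.

Lemma tvE i j : tv i j = subg elementary_group (transvection i j).
Proof. exact: (svalP tv_sealed). Qed.

Lemma elem_mx_tv i j : i != j -> elem_mx (tv i j) = transvection_mx i j.
Proof.
by move=> ij; rewrite /elem_mx tvE subgK ?transvection_in // val_transvection.
Qed.

Lemma tv_commg i j k : i != j -> j != k -> i != k ->
  [~ tv i j, tv j k] = tv i k.
Proof.
move=> ij jk ik; apply: (@mulgI _ (tv j k * tv i j)); rewrite -commgC.
by apply: elem_mul_eq; rewrite !elem_mx_tv //; exact: transvection_mx_comm.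
Qed.

(** Closure under inverses comes from finiteness. *)
Lemma elemg_gen (Q : elemg -> Prop) : Q 1 ->
  (forall s t, Q s -> Q t -> Q (s * t)) ->
  (forall i j, i != j -> Q (tv i j)) -> forall s, Q s.
Proof.
move=> Q1 QM Qtv s.
pose H := [set x in elementary_group | `[< Q (subg elementary_group x) >]]%SET.
have gH : group_set H.
  apply/group_setP; split=> [|x y].
    by rewrite inE group1; apply/asboolP; rewrite morph1.
  rewrite !inE => /andP[Gx /asboolP Qx] /andP[Gy /asboolP Qy].
  by rewrite groupM //; apply/asboolP; rewrite morphM //; exact: QM.
have : elementary_group \subset Group gH.
  rewrite gen_subG; apply/fintype.subsetP => x /imsetP[[i j] + ->].
  rewrite inE /= => ij.
  rewrite inE transvection_in //; apply/asboolP.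
  by have := Qtv i j ij; rewrite tvE.
move=> /fintype.subsetP /(_ (sgval s) (subgP s)); rewrite inE subgP => /asboolP.
by rewrite sgvalK.
Qed.

Lemma elemg_perfect : perfect_group elemg.
Proof.
apply/seteqP; split=> // s _ H [[H1 HM _] HR]; move: s.
apply: elemg_gen => // i k ik; have [j ji jk] := third_index i k.
by rewrite -(@tv_commg i j k) //; [apply: HR; do 2!eexists|rewrite eq_sym].
Qed.

Lemma tv_neq1 i j : i != j -> tv i j <> 1.
Proof.
move=> ij /(congr1 elem_mx); rewrite elem_mx_tv // elem_mx1 => /matrixP /(_ i j).
by rewrite !mxE (negPf ij) !eqxx.
Qed.

(** The image of t_ij commutes with every transvection commuting with t_ij, so it is 1 or t_ij. The
    Steinberg relations spread triviality from one transvection to all. *)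
Lemma elemg_central_endo (q : elemg -> elemg) : {morph q : s t / s * t} ->
  (forall s t, q [~ s, t] = [~ q s, t]) -> q =1 id \/ (forall s, q s = 1).
Proof.
move=> qM ql.
have qr s t : q [~ s, t] = [~ s, q t].
  by rewrite -[LHS]invgK -(morph_inv qM) invgR ql invgR.
have qtv i j : i != j -> q (tv i j) = 1 \/ q (tv i j) = tv i j.
  move=> ij.
  have := @comm_comm_transvection_mx (elem_mx (q (tv i j))) i j ij (elem_mx_unit _).
  case=> [k l kl kj li|e|e]; last 1 first.
  - by right; apply: elem_mx_inj; rewrite e elem_mx_tv.
  - have : commute (q (tv i j)) (tv k l).
      apply/commgP/eqP; rewrite -ql.
      suff -> : [~ tv i j, tv k l] = 1 by exact: morph_one.
      apply/eqP/commgP; apply/elem_commute; rewrite !elem_mx_tv //.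
      rewrite /transvection_mx !(mulmxDl, mulmxDr, mul1mx, mulmx1).
      rewrite !mul_delta_mx_cond (eq_sym j k) (negPf kj) (negPf li) !addr0.
      by rewrite -!addrA; congr (_ + _)%R; rewrite addrC.
    by move=> /elem_commute; rewrite elem_mx_tv.
  - by left; apply: elem_mx_inj.
have rowP i j k : i != j -> i != k -> q (tv i j) = 1 -> q (tv i k) = 1.
  move=> ij ik qij; have [<-//|jk] := eqVneq j k.
  by rewrite -(@tv_commg i j k) // ql qij comm1g.
have colP i j k : i != j -> k != j -> q (tv i j) = 1 -> q (tv k j) = 1.
  move=> ij kj qij; have [<-//|ik] := eqVneq i k.
  by rewrite -(@tv_commg k i j) // 1?eq_sym // qr qij commg1.
have allP i j r c : i != j -> r != c -> q (tv i j) = 1 -> q (tv r c) = 1.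
  (* The route is (i, j), (i, k), (r, k), (r, c). *)
  move=> ij rc qij; have [k ki kr] := third_index i r.
  rewrite eq_sym in ki; rewrite eq_sym in kr.
  exact: (rowP _ _ _ kr rc (colP _ _ _ ki kr (rowP _ _ _ ij ki qij))).
have n01 : ord0 != ord_max :> 'I_3 by [].
have [q1|q1] := pselect (q (tv ord0 ord_max) = 1); [right|left].
  apply: elemg_gen => [|s t qs qt|i j ij]; first exact: morph_one.
    by rewrite qM qs qt mulg1.
  exact: allP q1.
apply: elemg_gen => [|s t qs qt|i j ij]; first exact: morph_one.
  by rewrite qM qs qt.
by have [/(allP _ _ _ _ ij n01)|] := qtv i j ij.
Qed.

(** * The block groups *)

(* [(x, s, y, z)] stands for the block matrix [[1, x, z], [0, s, y], [0, 0, 1]]. *)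
Definition blockg (n : nat) : Type :=
  ('M['F_2]_(n, 3) * elemg * 'M['F_2]_(3, n) * 'M['F_2]_n)%type.

HB.instance Definition _ n := Finite.on (blockg n).

Section BlockGroup.
Variable n : nat.
Implicit Types (g h : blockg n) (x : 'M['F_2]_(n, 3)) (s : elemg)
  (y : 'M['F_2]_(3, n)) (z : 'M['F_2]_n).

Definition Block x s y z : blockg n := (x, s, y, z).
Definition bx g : 'M['F_2]_(n, 3) := g.1.1.1.
Definition bs g : elemg := g.1.1.2.
Definition by_ g : 'M['F_2]_(3, n) := g.1.2.
Definition bz g : 'M['F_2]_n := g.2.

Lemma bx_Block x s y z : bx (Block x s y z) = x. Proof. by []. Qed.
Lemma bs_Block x s y z : bs (Block x s y z) = s. Proof. by []. Qed.
Lemma by_Block x s y z : by_ (Block x s y z) = y. Proof. by []. Qed.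
Lemma bz_Block x s y z : bz (Block x s y z) = z. Proof. by []. Qed.
Definition BlockE := (bx_Block, bs_Block, by_Block, bz_Block).

Lemma block_eq g h : bx g = bx h -> bs g = bs h -> by_ g = by_ h -> bz g = bz h ->
  g = h.
Proof.
case: g => -[[? ?] ?] ?; case: h => -[[? ?] ?] ?.
by rewrite /bx /bs /by_ /bz /= => -> -> -> ->.
Qed.

Local Open Scope ring_scope.

Definition block_mul g h : blockg n :=
  Block (bx h + bx g *m elem_mx (bs h)) (bs g * bs h)%g
        (by_ g + elem_mx (bs g) *m by_ h) (bz g + bz h + bx g *m by_ h).

Definition block_one : blockg n := Block 0 1%g 0 0.

Definition block_inv g : blockg n :=
  Block (- (bx g *m elem_mx (bs g)^-1%g)) (bs g)^-1%g
        (- (elem_mx (bs g)^-1%g *m by_ g))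
        (bx g *m elem_mx (bs g)^-1%g *m by_ g - bz g).

Lemma elem_mxVK s : elem_mx s^-1%g *m elem_mx s = 1%:M.
Proof. by rewrite -elem_mxM mulVg. Qed.

Lemma elem_mxKV s : elem_mx s *m elem_mx s^-1%g = 1%:M.
Proof. by rewrite -elem_mxM mulgV. Qed.

Lemma block_mulA : associative block_mul.
Proof.
move=> g h k; apply: block_eq; rewrite /block_mul ?/block_one ?/block_inv !BlockE.
- by rewrite elem_mxM mulmxDl mulmxA addrA.
- exact: mulgA.
- by rewrite elem_mxM mulmxDr mulmxA addrA.
- rewrite mulmxDr mulmxDl !mulmxA !addrA; congr (_ + _).
  by rewrite [LHS]addrAC; congr (_ + _); rewrite addrAC.
Qed.

Lemma block_mul1 : left_id block_one block_mul.
Proof.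
move=> g; apply: block_eq; rewrite /block_mul ?/block_one ?/block_inv !BlockE.
- by rewrite mul0mx addr0.
- exact: mul1g.
- by rewrite elem_mx1 mul1mx add0r.
- by rewrite mul0mx add0r addr0.
Qed.

Lemma block_mulr1 : right_id block_one block_mul.
Proof.
move=> g; apply: block_eq; rewrite /block_mul ?/block_one ?/block_inv !BlockE.
- by rewrite elem_mx1 mulmx1 add0r.
- exact: mulg1.
- by rewrite mulmx0 addr0.
- by rewrite mulmx0 !addr0.
Qed.

Lemma block_mulV : left_inverse block_one block_inv block_mul.
Proof.
move=> g; apply: block_eq; rewrite /block_mul ?/block_one ?/block_inv !BlockE.
- by rewrite mulNmx -mulmxA elem_mxVK mulmx1 subrr.
- exact: mulVg.
- by rewrite addNr.
- by rewrite mulNmx subrK subrr.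
Qed.

Lemma block_mulrV : right_inverse block_one block_inv block_mul.
Proof.
move=> g; apply: block_eq; rewrite /block_mul ?/block_one ?/block_inv !BlockE.
- by rewrite addNr.
- exact: mulgV.
- by rewrite mulmxN mulmxA elem_mxKV mul1mx subrr.
- by rewrite mulmxN mulmxA addrCA subrr addr0 subrr.
Qed.

HB.instance Definition _ := isGroup.Build (blockg n)
  block_mulA block_mul1 block_mulr1 block_mulV block_mulrV.

Local Close Scope ring_scope.

Lemma bsM : {morph bs : g h / g * h}. Proof. by []. Qed.

Lemma bxM g h : bx (g * h) = (bx h + bx g *m elem_mx (bs h))%R.
Proof. by []. Qed.

Lemma byM g h : by_ (g * h) = (by_ g + elem_mx (bs g) *m by_ h)%R.
Proof. by []. Qed.

Lemma bzM g h : bz (g * h) = (bz g + bz h + bx g *m by_ h)%R.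
Proof. by []. Qed.

Lemma bzV g : bz g^-1 = (bx g *m elem_mx (bs g)^-1 *m by_ g - bz g)%R.
Proof. by []. Qed.

Definition blockME := (bxM, bsM, byM, bzM).

Definition blockX x := Block x 1 0%R 0%R.
Definition blockS s := Block 0%R s 0%R 0%R.
Definition blockY y := Block 0%R 1 y 0%R.
Definition blockZ z := Block 0%R 1 0%R z.

Lemma blockSM : {morph blockS : s t / s * t}.
Proof.
move=> s t; apply: block_eq; rewrite !blockME /blockS !BlockE;
  by rewrite ?mul0mx ?mulmx0 ?addr0.
Qed.

Lemma blockXD x x' : blockX (x + x')%R = blockX x' * blockX x.
Proof.
apply: block_eq; rewrite !blockME ?/blockX ?/blockY ?/blockZ !BlockE
  ?elem_mx1 ?mulg1 //;
  by rewrite ?mulmx1 ?mulmx0 ?addr0.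
Qed.

Lemma blockYD y y' : blockY (y + y')%R = blockY y * blockY y'.
Proof.
apply: block_eq; rewrite !blockME ?/blockX ?/blockY ?/blockZ !BlockE
  ?elem_mx1 ?mulg1 //;
  by rewrite ?mul1mx ?mul0mx ?addr0.
Qed.

Lemma blockZD z z' : blockZ (z + z')%R = blockZ z * blockZ z'.
Proof.
apply: block_eq; rewrite !blockME ?/blockX ?/blockY ?/blockZ !BlockE
  ?elem_mx1 ?mulg1 //;
  by rewrite ?mul1mx ?mul0mx ?mulmx0 ?addr0.
Qed.

Lemma block_decomp g :
  g = blockZ (bz g) * (blockY (by_ g) * (blockS (bs g) * blockX (bx g))).
Proof.
apply: block_eq; rewrite !blockME ?/blockX ?/blockS ?/blockY ?/blockZ !BlockE
  ?elem_mx1 ?mul1g ?mulg1 //;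
  by rewrite ?mul1mx ?mul0mx ?mulmx0 ?addr0 ?add0r.
Qed.

Lemma blockZ_central z g : commute (blockZ z) g.
Proof.
apply: block_eq; rewrite !blockME ?/blockX ?/blockS ?/blockY ?/blockZ !BlockE
  ?elem_mx1 ?mul1g ?mulg1 //;
  by rewrite ?mul1mx ?mulmx1 ?mul0mx ?mulmx0 ?addr0 ?add0r // addrC.
Qed.

Lemma commg_eq (G : groupType) (a b c : G) : a * b = b * a * c -> [~ a, b] = c.
Proof. by rewrite (commgC a b) => /mulgI. Qed.

Lemma commg_blockXS x s :
  [~ blockX x, blockS s] = blockX (x *m elem_mx s - x)%R.
Proof.
apply: commg_eq.
apply: block_eq; rewrite !blockME ?/blockX ?/blockS ?/blockY ?/blockZ !BlockE
  ?elem_mx1 ?mul1g ?mulg1 //;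
  by rewrite ?mulmx1 ?mul0mx ?mulmx0 ?addr0 ?add0r ?subrK.
Qed.

(** The inverses turn the commutator into s y s^-1 y^-1, which suits the left action of [s] on
    [y]. *)
Lemma commg_blockSY s y :
  [~ (blockS s)^-1, (blockY y)^-1] = blockY (elem_mx s *m y - y)%R.
Proof.
apply: (@mulIg _ (blockY y * blockS s)); rewrite -commgCV.
apply: block_eq; rewrite !blockME ?/blockX ?/blockS ?/blockY ?/blockZ !BlockE
  ?elem_mx1 ?mul1g ?mulg1 //;
  by rewrite ?mul1mx ?mulmx1 ?mul0mx ?mulmx0 ?addr0 ?add0r ?subrK.
Qed.

(** The kernel of [bs] is nilpotent of class at most 2, with commutators in the central corner. *)
Lemma commg_ker_bs g h : bs g = 1 -> bs h = 1 ->
  [~ g, h] = blockZ (bx g *m by_ h - bx h *m by_ g)%R.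
Proof.
move=> g1 h1; apply: commg_eq.
apply: block_eq; rewrite !blockME ?/blockX ?/blockS ?/blockY ?/blockZ !BlockE
  ?g1 ?h1 ?elem_mx1 ?mul1g ?mulg1 //.
- by rewrite !mulmx1 add0r addrC.
- by rewrite !mul1mx addr0 addrC.
- rewrite mulmx0 addr0 -[RHS]addrA (addrC (bx h *m by_ g)%R) subrK.
  by rewrite (addrC (bz g)).
Qed.

Lemma commg_blockXY x y : [~ blockX x, blockY y] = blockZ (x *m y)%R.
Proof. by rewrite commg_ker_bs //= mulmx0 subr0. Qed.


(** A is the sum of the matrices A E_jj, that is, of its columns. *)
Lemma mx_diag_ind m k (Q : 'M['F_2]_(m, k) -> Prop) : Q 0%R ->
  (forall A B, Q A -> Q B -> Q (A + B)%R) ->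
  (forall A j, Q (A *m delta_mx j j)%R) -> forall A, Q A.
Proof.
move=> Q0 QD Qd A; rewrite -[A]mulmx1 mx1_sum_delta mulmx_sumr.
by elim/big_ind: _.
Qed.

Lemma blockg_perfect : perfect_group (blockg n).
Proof.
apply/seteqP; split=> // g _ H HH.
have [[H1 HM HV] HR] := HH.
have HZ z : H (blockZ z).
  elim/mx_diag_ind: z => [//|A B HA HB|A j]; first by rewrite blockZD; exact: HM.
  (* Factoring E_jj = E_j0 E_0j through the middle block exhibits a commutator. *)
  rewrite -(mul_delta_mx (ord0 : 'I_3)) mulmxA -commg_blockXY.
  by apply: HR; do 2!eexists.
have HX x : H (blockX x).
  elim/mx_diag_ind: x => [//|A B HA HB|A j]; first by rewrite blockXD; exact: HM.
  have [k kj _] := third_index j j.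
  rewrite -(mul_delta_mx k) mulmxA.
  set a := (A *m _)%R.
  (* Here A E_jj = a E_kj with a = A E_jk, and a E_kj = a t_kj - a. *)
  have -> : (a *m delta_mx k j = a *m elem_mx (tv k j) - a)%R.
    by rewrite elem_mx_tv // /transvection_mx mulmxDr mulmx1 addrC addKr.
  by rewrite -commg_blockXS; apply: HR; do 2!eexists.
have HY y : H (blockY y).
  (* Transposing gives induction on rows, on which [s] acts from the left. *)
  rewrite -[y]trmxK; elim/mx_diag_ind: (y^T)%R => [|A B HA HB|A j].
  - by rewrite trmx0.
  - by rewrite linearD blockYD; exact: HM.
  have [k kj _] := third_index j j; rewrite eq_sym in kj.
  rewrite trmx_mul trmx_delta -(mul_delta_mx k) -mulmxA.
  set a := (_ *m A^T)%R.
  have -> : (delta_mx j k *m a = elem_mx (tv j k) *m a - a)%R.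
    by rewrite elem_mx_tv // /transvection_mx mulmxDl mul1mx addrC addKr.
  by rewrite -commg_blockSY; apply: HR; do 2!eexists.
have HS s : H (blockS s).
  apply: (perfect_morph_sub blockSM elemg_perfect) => // s1 s2.
  by apply: HR; do 2!eexists.
by rewrite (block_decomp g); do ![apply: (HM)].
Qed.

(** Perfection is used three times: [bs] kills the image of [e], so commutators of images lie in the
    corner, so the whole image does and is central, so it is trivial. *)
Lemma projection_blockg_trivial (e : blockg n -> blockg n) :
  direct_projection e -> (forall s, bs (e (blockS s)) = 1) -> forall g, e g = 1.
Proof.
move=> pe es1; have [eM _ ec] := pe.
have bse g : bs (e g) = 1.
  apply: (@perfect_morph_commute _ _ (fun g => bs (e g))); last 2 first.
  - exact: blockg_perfect.
  (* For k = [blockS (bs (e h))], [e g] commutes with e(k)^-1 k, whose [bs] is that of [e h]. *)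
  - move=> {}g h; have := ec g (blockS (bs (e h))).
    by move=> /(congr1 bs); rewrite !bsM morph_inv // es1 invg1 !mul1g.
  - by move=> {}g h; rewrite eM.
apply: perfect_morph_commute => //; first exact: blockg_perfect.
suff eZ g : exists z, e g = blockZ z.
  by move=> g h; have [z ->] := eZ g; exact: blockZ_central.
apply: (@perfect_morph_sub _ _ e eM [set g | exists z, g = blockZ z]).
- exact: blockg_perfect.
- split=> [|_ _ [z ->] [z' ->]|_ [z ->]]; first by exists 0%R.
    by exists (z + z')%R; rewrite blockZD.
  exists (- z)%R; apply: (@mulgI _ (blockZ z)).
  by rewrite mulgV -blockZD subrr.
- by move=> h k /=; rewrite commg_ker_bs //; eexists.
Qed.

(** The map induced on [elemg] is trivial or the identity; the second case reduces to the first for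
    the complementary projection. *)
Lemma blockg_only_trivial_projections : only_trivial_projections (blockg n).
Proof.
move=> e pe; have [eM _ _] := pe.
have [|s t|q1|q1] := @elemg_central_endo (fun s => bs (e (blockS s))).
- by move=> s t; rewrite blockSM eM.
- by rewrite (morph_commg blockSM) direct_projection_commgl // (morph_commg bsM).
- left=> g; apply/eqP; rewrite eq_sym -divg_eq1; apply/eqP.
  have pe' := direct_projection_compl pe.
  have : (e g)^-1 * g = 1.
    apply: (projection_blockg_trivial pe') => s.
    by rewrite bsM morph_inv // q1 mulVg.
  by move=> /mulg1_eq; rewrite invgK => ->; rewrite mulgV.
- by right; exact: projection_blockg_trivial.
Qed.

Lemma blockg_nontrivial : nontrivial_group (blockg n).
Proof.
exists (blockS (tv ord0 ord_max)) => /(congr1 bs).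
exact: tv_neq1.
Qed.

End BlockGroup.

(** * Failure for the whole family *)

(* Zorn's lemma yields a subgroup maximal among those containing [N0] and
   avoiding [z]; since it contains all squares, its index is 2. *)
Lemma index2_morph (P : groupType) (N0 : set P) (z : P) : is_subgroup N0 ->
  (forall x, N0 (x * x)) -> ~ N0 z ->
  exists h : P -> bool, [/\ {morph h : x y / x * y >-> x (+) y},
    forall x, N0 x -> h x = false & h z = true].
Proof.
move=> N0g N0sq N0z.
pose good (X : set P) := [/\ is_subgroup X, N0 `<=` X & ~ X z].
have [F Fgood Ftot|N [[[[N1 NM NV] N0N Nz]|Nempty] Nmax]] :=
  @Zorn_bigcup P (good `|` [set set0]).
- have [[X FX Xgood]|noX] := pselect (exists2 X, F X & good X); last first.
    right; apply/seteqP; split=> // x [X FX Xx].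
    have [Xgood|X0] := Fgood X FX; first by apply: noX; exists X.
    by move: Xx; rewrite X0.
  left; have [[X1 _ _] N0X _] := Xgood.
  have Fgood' Y y : F Y -> Y y -> good Y.
    by move=> FY Yy; have [//|Y0] := Fgood Y FY; move: Yy; rewrite Y0.
  split.
  - split=> [|x y [Y FY Yx] [Y' FY' Yy]|x [Y FY Yx]]; first by exists X.
      have [[_ YM _] _ _] := Fgood' _ _ FY Yx.
      have [[_ YM' _] _ _] := Fgood' _ _ FY' Yy.
      by have [YY'|Y'Y] := Ftot _ _ FY FY';
        [exists Y' => //; apply: YM' => //; exact: YY'
        |exists Y => //; apply: YM => //; exact: Y'Y].
    by exists Y => //; have [[_ _ YV] _ _] := Fgood' _ _ FY Yx; exact: YV.
  - by move=> x N0x; exists X => //; exact: N0X.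
  - by move=> [Y FY Yz]; have [_ _] := Fgood' _ _ FY Yz.
- have Nsq x : N (x * x) by exact/N0N/N0sq.
  (* Otherwise the union of [N] and its coset xN would be a larger subgroup still avoiding [z]. *)
  have Nout x : ~ N x -> N (x^-1 * z).
    move=> Nx; apply: contrapT => nxz.
    pose X := N `|` [set y | N (x^-1 * y)].
    have NX : N `<` X.
      split; first by move=> y Ny; left.
      by move=> XN; apply/Nx/XN; right; rewrite /= mulVg.
    apply: (Nmax X NX); left; split; last first.
    + by case.
    + by move=> y N0y; left; exact: N0N.
    (* Conjugation is expressed by squares: x^-1 y x = x^-2 (x y)^2 y^-1. *)
    have xN y : N y -> N (x^-1 * (y * x)).
      move=> Ny; rewrite (_ : _ * _ = (x^-1 * x^-1) * ((x * y) * (x * y)) * y^-1).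
        by apply: (NM); [apply: (NM) => //; rewrite -group_invM|]; exact: NV.
      by rewrite -!mulgA mulKg mulgV mulg1.
    split; first by left.
      move=> y y' [Ny|/= Ny] [Ny'|/= Ny'].
      - by left; exact: NM.
      - right; rewrite /= (_ : _ * _ = (x^-1 * (y * x)) * (x^-1 * y')).
          by apply: (NM) => //; exact: xN.
        by rewrite -!mulgA mulVKg.
      - by right; rewrite /= mulgA; exact: NM.
      - left; rewrite (_ : y * y' = (x * x) * (x^-1 * ((x^-1 * y) * x)) * (x^-1 * y')).
          by apply: (NM) => //; apply: (NM) => //; exact: xN.
        by rewrite -!mulgA !mulVKg.
    move=> y [Ny|/= Ny]; first by left; exact: NV.
    right; rewrite /= (_ : _ * _ = (x^-1 * ((x^-1 * y)^-1 * x)) * (x * x)^-1).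
      by apply: (NM); [apply/xN/NV|exact: NV].
    by rewrite !group_invM invgK -!mulgA mulVKg mulgV mulg1.
  exists (fun x => ~~ `[< N x >]); split=> [x y|x N0x|].
  + have [Nx|Nx] := pselect (N x); have [Ny|Ny] := pselect (N y).
    * by rewrite !asboolT //; exact: NM.
    * rewrite (asboolT Nx) (asboolF Ny) asboolF // => Nxy; apply: Ny.
      by rewrite -(mulKg x y); apply: (NM) => //; exact: NV.
    * rewrite (asboolF Nx) (asboolT Ny) asboolF // => Nxy; apply: Nx.
      by rewrite -(mulgK y x); apply: (NM) => //; exact: NV.
    (* Both [x] and [y] lie in the coset of [z], so their product lies in [N]. *)
    * rewrite (asboolF Nx) (asboolF Ny) asboolT //.
      rewrite (_ : x * y = (x * x) * ((x^-1 * z) * (y^-1 * z)^-1)).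
        by apply: (NM) => //; apply: (NM); [exact: Nout|apply/NV/Nout].
      by rewrite group_invM invgK -!mulgA !mulVKg.
  + by rewrite asboolT //; exact: N0N.
  + by rewrite asboolF.
- exfalso; apply: (Nmax N0); last by left; split.
  have [N01 _ _] := N0g; rewrite Nempty; split=> // N0e.
  exact: (N0e 1).
Qed.

(** * Full products as reduced products by the ideal {∅} *)

Section TrivialIdeal.
Variables (I : Type) (G : I -> groupType).

Lemma empty_ideal0 : [set A : set I | A = set0] set0. Proof. by []. Qed.

Lemma empty_idealS A B : A `<=` B -> [set A : set I | A = set0] B ->
  [set A : set I | A = set0] A.
Proof. by move=> AB /= B0; apply/seteqP; split=> // i /AB; rewrite B0. Qed.

Lemma empty_idealU A B : [set A : set I | A = set0] A ->
  [set A : set I | A = set0] B -> [set A : set I | A = set0] (A `|` B).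
Proof. by move=> /= -> ->; rewrite setU0. Qed.

Definition empty_ideal : ideal I := Ideal empty_ideal0 empty_idealS empty_idealU.

Implicit Types (a b : forall i, G i) (x y : redprod G empty_ideal).

Lemma empty_class_inj a b i :
  prodg_class empty_ideal a = prodg_class empty_ideal b -> a i = b i.
Proof.
move=> /prodg_classP /= ab0; apply: contrapT => nab.
by suff : set0 i by []; rewrite -ab0.
Qed.

Lemma repr_empty_class a i : repr (prodg_class empty_ideal a) i = a i.
Proof. by apply: empty_class_inj; rewrite prodg_class_repr. Qed.

Lemma repr_emptyM x y i : repr (x * y) i = repr x i * repr y i.
Proof. by rewrite [x * y]/(redprod_mul x y) repr_empty_class. Qed.

Lemma repr_emptyV x i : repr x^-1 i = (repr x i)^-1.
Proof. by rewrite [x^-1]/(redprod_inv x) repr_empty_class. Qed.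

Lemma repr_empty1 i : repr (1 : redprod G empty_ideal) i = 1.
Proof. by rewrite [1]/(redprod_one _ _) repr_empty_class. Qed.

Lemma redprod_empty_eq x y : (forall i, repr x i = repr y i) -> x = y.
Proof.
move=> xy; rewrite -(prodg_class_repr x) -(prodg_class_repr y).
by congr prodg_class; apply: functional_extensionality_dep.
Qed.

Lemma repr_empty_mask S x i : repr (redprod_mask S x) i = mask S (repr x) i.
Proof. exact: repr_empty_class. Qed.

End TrivialIdeal.

(** The extra term of the corner factors through the middle block of size 3. *)
Lemma mxrank_bzM n (g h : blockg n) :
  (\rank (bz (g * h)%g) <= \rank (bz g) + \rank (bz h) + 3)%N.
Proof.
rewrite bzM; apply: leq_trans (mxrank_add _ _) _; apply: leq_add.
  exact: mxrank_add.
exact: mulmx_max_rank.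
Qed.

Lemma mxrank_bzV n (g : blockg n) : (\rank (bz g^-1%g) <= \rank (bz g) + 3)%N.
Proof.
rewrite bzV addrC; apply: leq_trans (mxrank_add _ _) _.
by rewrite mxrank_opp leq_add2l; exact: mulmx_max_rank.
Qed.

(** In characteristic 2 the two corners cancel, leaving only the term of rank at most 3. *)
Lemma mxrank_bz_square n (g : blockg n) : (\rank (bz (g * g)%g) <= 3)%N.
Proof.
rewrite bzM (_ : bz g + bz g = 0)%R ?add0r; first exact: mulmx_max_rank.
by apply/matrixP => i j; rewrite !mxE F2_addrr.
Qed.

Lemma blockg_not_recognizes :
  ~ recognizes_coordinates (groups_of (fun n => blockg n : groupType) setT).
Proof.
(* [id_seq] has unbounded ranks, so some [h : M -> Z/2] is nontrivial on it but
   kills all sequences of bounded rank. Multiplying by the central element [d],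
   supported at index 1, according to [h] makes coordinate 1 of the result
   depend both on coordinate 1 and on the remaining ones. *)
pose M : groupType := redprod (fun n => blockg n : groupType) (empty_ideal nat).
pose bounded : set M :=
  [set x | exists c, forall n, (\rank (bz (repr x n)) <= c)%N].
pose id_seq : M := prodg_class _ (fun n => blockZ (1%:M)%R).
(* Index 1, because the corner of [blockg 0] is empty and would make [d] trivial. *)
pose at1 : set nat := [set 1%N].
pose d : M := redprod_mask at1 id_seq.
have [|||h [hM hb hid]] := @index2_morph M bounded id_seq.
- split=> [|x y [c xc] [c' yc]|x [c xc]].
  + by exists 0%N => n; rewrite repr_empty1 mxrank0.
  + exists (c + c' + 3)%N => n; rewrite repr_emptyM.
    apply: leq_trans (mxrank_bzM _ _) _.
    by rewrite leq_add2r; apply: leq_add.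
  + exists (c + 3)%N => n; rewrite repr_emptyV.
    by apply: leq_trans (mxrank_bzV _) _; rewrite leq_add2r.
- by move=> x; exists 3 => n; rewrite repr_emptyM; exact: mxrank_bz_square.
- move=> [c /(_ c.+1)].
  by rewrite repr_empty_class [bz _]/(1%:M)%R mxrank1 ltnn.
have dE n : repr d n = if n == 1%N then blockZ (1%:M)%R else 1.
  rewrite repr_empty_mask; have [->|/eqP n1] := eqVneq n 1%N.
    by rewrite mask_in ?repr_empty_class.
  by rewrite mask_out.
have dC x : commute d x.
  apply: redprod_empty_eq => n; rewrite !repr_emptyM dE.
  by case: ifP => _; [exact: blockZ_central|rewrite mul1g mulg1].
have dd : d * d = 1.
  apply: redprod_empty_eq => n; rewrite repr_emptyM repr_empty1 dE.
  case: ifP => _; last by rewrite mulg1.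
  rewrite -blockZD (_ : _ + _ = 0)%R //.
  by apply/matrixP => i j; rewrite !mxE F2_addrr.
(* The rank of [d] is at most 1 everywhere. This makes [Phi] an involution. *)
have hd : h d = false.
  apply: hb; exists 1%N => n; rewrite dE; case: eqP => [->|_];
    first exact: rank_leq_row.
  by rewrite [bz _]/(0%R) mxrank0.
pose Phi x : M := x * (if h x then d else 1).
have PhiM : {morph Phi : x y / x * y}.
  move=> x y; rewrite /Phi hM; case: (h x); case: (h y); rewrite /= ?mulg1 ?mulgA //.
    by rewrite -(mulgA x d y) (dC y) !mulgA -(mulgA _ d) dd mulg1.
  by rewrite -(mulgA x d y) (dC y) mulgA.
have PhiK : involutive Phi.
  move=> x; rewrite /Phi; case hx: (h x); rewrite ?mulg1 ?hx ?mulg1 //.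
  by rewrite hM hx hd /= -mulgA dd mulg1.
pose PhiH := isMultiplicative.Build M M Phi PhiM.
pose Phi' : {multiplicative M -> M} := HB.pack Phi PhiH.
have d1 : repr d 1%N <> 1.
  rewrite dE eqxx => /(congr1 (@bz 1)) /matrixP /(_ ord0 ord0).
  by rewrite !mxE eqxx.
have mask1 S : S 1%N -> redprod_mask S d <> 1.
  move=> S1 /(congr1 (fun x : M => repr x 1%N)).
  by rewrite repr_empty_mask repr_empty1 mask_in.
move=> rec.
have proper : proper_ideal (empty_ideal nat).
  by move=> /= T0; have : @setT nat 0%N by []; rewrite T0.
have inC n : groups_of (fun n => blockg n : groupType) setT (blockg n) by exists n.
have PhiB : bijective Phi' by exists Phi; exact: PhiK.
have [alpha [_ [_ _ _ _ alphaC]] resp] :=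
  rec _ _ _ _ _ _ proper proper inC inC _ PhiB.
have {}resp s x : redprod_mask (repr s) x = 1 ->
    redprod_mask (repr (alpha s)) (Phi x) = 1.
  have m1 S : redprod_mask S (1 : M) = 1 by exact/morph_one/redprod_maskM.
  move=> mx; rewrite -(m1 (repr (alpha s))) -(morph_one PhiM).
  by apply/redprod_proj_mask/resp/redprod_proj_mask; rewrite m1.
have md : redprod_mask at1 d = d by rewrite redprod_maskI setIid.
pose S := set_class (empty_ideal nat) at1.
have [T1|T1] := pselect (repr (alpha S) 1%N).
  (* [d * id_seq] is trivial at index 1, but [h] is nonzero on it, so its image [id_seq] is not. *)
  have /resp : redprod_mask (repr S) (d * id_seq) = 1.
    by rewrite redprod_mask_class redprod_maskM md dd.
  rewrite /Phi hM hd hid /= -(mulgA d) -(dC id_seq) mulgA dd mul1g.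
  move=> /(congr1 (fun x : M => repr x 1%N)).
  rewrite repr_empty_mask repr_empty1 mask_in // => id1; apply: d1.
  by rewrite dE eqxx -id1 repr_empty_class.
(* Now 1 lies in the image of the complement of [S], where [d] is trivial; but [Phi] fixes [d]. *)
have /resp : redprod_mask (repr (~` S)%O) d = 1.
  by rewrite redprod_mask_class redprod_maskC redprod_mask_class md mulVg.
rewrite /Phi hd mulg1 alphaC redprod_mask_class.
exact: mask1.
Qed.

Theorem theorem7p1 :
  exists (K : Type) (D : K -> groupType),
    [/\ ~ recognizes_coordinates (groups_of D setT),
        forall A : set K, finite_set A -> recognizes_coordinates (groups_of D A),
        forall k : K, indecomposable_group (D k),
        forall k : K, perfect_group (D k) &
        forall (k l : K) (f : {multiplicative D k -> D l}),
          (forall x : D k, group_center (D l) (f x)) ->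
          forall x : D k, f x = 1%g].
Proof.
exists nat, (fun n => blockg n : groupType); split.
- exact: blockg_not_recognizes.
- move=> A finA; apply: finite_family_recognizes_coordinates => // n.
  + exact: finite_finset.
  + exact: blockg_perfect.
  + exact: blockg_only_trivial_projections.
  + exact: blockg_nontrivial.
- move=> n; apply: only_trivial_projections_indecomposable.
  exact: blockg_only_trivial_projections.
- exact: blockg_perfect.
- move=> k l f fZ; apply: perfect_morph_commute.
  + exact: gmulfM.
  + exact: blockg_perfect.
  + by move=> x y; exact: fZ.
Qed.
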